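(* Let $\mathfrak{h}$ be a complex vector space of finite dimension $d$ with a nondegenerate symmetric bilinear form $\langle\cdot,\cdot\rangle$ and orthonormal basis $\bar\alpha_1,\ldots,\bar\alpha_d$, let $\nu$ be an isometry of $\mathfrak{h}$ with $\nu^p=1$ ($p$ a positive integer), and let $\omega_p\in\mathbb{C}$ be a primitive $p$-th root of unity. Let $S$ be the Heisenberg vertex operator algebra of $\mathfrak h$, $S[\nu]$ the level-one induced $\hat{\mathfrak h}[\nu]$-module, and $Y_{S[\nu]}(\cdot,x)$ and $W(\cdot,x)$ the linear maps from $S$ to $(\mathrm{End}\,S[\nu])[[x^{1/p},x^{-1/p}]]$ defined in the context. Then $$Y_{S[\nu]}(v,x)=W(e^{\Delta_x}v,x)\qquad(v\in S),$$ where $\Delta_x$ is the formal operator on $S$ given by $$\Delta_x=\sum_{q_1,q_2=1}^d\ \sum_{m,n\ge1}\frac{\bar\alpha_{q_1}(m)\,\bar\alpha_{q_2}(n)}{mn}\;g(\bar\alpha_{q_1},m,\bar\alpha_{q_2},n,x).$$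
   Context: Conventions: $x^{1/p}$ is a formal variable whose $p$-th power is $x$; powers (integral or fractional) of binomials are expanded in nonnegative integral powers of the second variable; $\mathrm{Res}_x$ extracts the coefficient of $x^{-1}$. $S$: let $\hat{\mathfrak h}=\coprod_{n\in\mathbb{Z}}\mathfrak h\otimes t^n\oplus\mathbb{C}C$ with $C$ central and $[\alpha\otimes t^m,\beta\otimes t^n]=\langle\alpha,\beta\rangle m\,\delta_{m+n,0}C$; $S$ is the $\hat{\mathfrak h}$-module induced from the one-dimensional module $\mathbb{C}$ of $\coprod_{n\ge0}\mathfrak h\otimes t^n\oplus\mathbb{C}C$ on which $\mathfrak h\otimes t^n$ ($n\ge0$) acts as $0$ and $C$ as $1$; $\alpha(n)$ denotes the action of $\alpha\otimes t^n$ on $S$ and $\mathbf 1=1\in S$. $S$ is spanned by the vectors $\alpha_j(-n_j)\cdots\alpha_1(-n_1)\mathbf 1$ with $\alpha_i\in\mathfrak h$, $n_i\geq 1$. $S[\nu]$: for $r\in\mathbb{Z}$, $\mathfrak h_{(r)}=\{\alpha\in\mathfrak h:\nu\alpha=\omega_p^r\alpha\}$, and $\alpha_{(r)}$ is the projection of $\alpha$ on $\mathfrak h_{(r)}$. $\hat{\mathfrak h}[\nu]=\coprod_{n\in\frac1p\mathbb{Z}}\mathfrak h_{(pn)}\otimes t^n\oplus\mathbb{C}C$ with $C$ central and $[\alpha\otimes t^m,\beta\otimes t^n]=\langle\alpha,\beta\rangle m\,\delta_{m+n,0}C$ for $\alpha\in\mathfrak h_{(pm)}$, $\beta\in\mathfrak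 h_{(pn)}$; $S[\nu]$ is the $\hat{\mathfrak h}[\nu]$-module induced from the one-dimensional module of $\coprod_{n\ge0}\mathfrak h_{(pn)}\otimes t^n\oplus\mathbb{C}C$ on which $\mathfrak h_{(pn)}\otimes t^n$ ($n\ge0$) acts as $0$ and $C$ as $1$. For $\alpha\in\mathfrak h$, $\alpha^\nu(n)$ is the action of $\alpha_{(pn)}\otimes t^n$ on $S[\nu]$ and $\alpha^\nu(x)=\sum_{n\in\frac1p\mathbb{Z}}\alpha^\nu(n)x^{-n-1}$. Normal ordering ${:}\cdot{:}$ places $\alpha^\nu(n)$ with $n>0$ to the right; an empty normal-ordered product is the identity. $W$: for $\alpha_i\in\mathfrak h$, $n_i\geq1$, $$W(\alpha_1(-n_1)\cdots\alpha_j(-n_j)\mathbf 1,x)={:}\prod_{l=1}^j\frac1{(n_l-1)!}\Big(\frac d{dx}\Big)^{n_l-1}\alpha_l^\nu(x){:},$$ extended linearly, with $W(f(x)v,x)=f(x)W(v,x)$ for $f(x)\in\mathbb{C}[x,x^{-1}]$. For $\alpha,\beta\in\mathfrak h$ and integers $m,n\ge1$, $$g(\alpha,m,\beta,n,x)=\mathrm{Res}_{x_0}\mathrm{Res}_{x_2}\,x_0^{-m}x_2^{-n}\sum_{r=1}^p\Big(\frac{x+x_2}{x+x_0}\Big)^{\frac rp}\frac{1-\frac rp+\frac rp\frac{x+x_0}{x+x_2}}{(x_0-x_2)^2}\langle\alpha_{(r)},\beta\rangle .$$ $Y_{S[\nu]}$ is the twisted vertex operator map of $S[\nu]$ given by $$Y_{S[\nu]}(\alpha_j(-n_j)\cdots\alpha_1(-n_1)\mathbf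 1,x)=\sum_{J\subset\{1,\ldots,j\}}f_{\{1,\ldots,j\}\setminus J}(x)\;{:}\prod_{l\in J}\frac1{(n_l-1)!}\Big(\frac d{dx}\Big)^{n_l-1}\alpha_l^\nu(x){:}$$ where $f_I(x)=0$ if $|I|$ is odd, and if $|I|$ is even $f_I(x)$ is the sum, over all partitions of $I$ into unordered pairs $\{i,i'\}$ of distinct elements, of the product over the pairs of $g(\alpha_i,n_i,\alpha_{i'},n_{i'},x)$ (with $f_\varnothing=1$; $g$ is symmetric under $(\alpha,m)\leftrightarrow(\beta,n)$).
   Formalization: The formal theorem has a factor 1/2 in front of the sum defining Δ_x; without it the identity fails, e.g. for d=1, p=2, ν=−1, v=α(−1)α(−1)1, since each contraction occurs twice in the ordered sum but once in f_I. *)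

(* Defs.v *)
From mathcomp Require Import all_boot all_order all_algebra.
From mathcomp Require Import boolp classical_sets functions cardinality fsbigop.

Set Implicit Arguments.
Unset Strict Implicit.
Unset Printing Implicit Defensive.

Import Order.TTheory GRing.Theory Num.Theory.

Local Open Scope classical_set_scope.
Local Open Scope ring_scope.

(* Infinite sums are written [\sum_(i \in A) F i]: the sum of [F] over [A] when
   [F] has finite support in [A].  They are only used at places where the
   support is finite, coefficient by coefficient (and vector by vector). *)

(* A series in powers of x^{1/p} with coefficients in [V] is a function
   [u : int -> V]; [u k] is the coefficient of x^{k/p}. *)
Section Series.
Variables (K : fieldType) (V : lmodType K).

Definition ser_mul (c : int -> K) (u : int -> V) : int -> V :=
  fun k => \sum_(l \in [set: int]) c l *: u (k - l).

Definition ser_const (v : V) : int -> V := fun k => if k == 0 then v else 0.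

End Series.

Definition gbinom (K : fieldType) (a : K) (i : nat) : K :=
  (\prod_(0 <= j < i) (a - j%:R)) / (i`!)%:R.

(* Series in x^{1/p}, x_0, x_2 with coefficients in [K]: [F (k, i, j)] is the
   coefficient of x^{k/p} x_0^i x_2^j. *)
Section Kernel.
Variables (K : fieldType) (p : nat).

Local Notation mono3 := (int * int * int)%type.
Definition ser3 : Type := mono3 -> K.

Definition ser3_mul (F G : ser3) : ser3 :=
  fun e => \sum_(e' \in [set: mono3]) F e' * G (e - e').

(* The expansion of (y + eps z)^a in nonnegative powers of z; [ya], [y], [z] are
   the exponents of the monomials y^a, y, z. *)
Definition binomial_exp (ya y z : mono3) (eps a : K) : ser3 :=
  fun e => \sum_(i \in [set i : nat | e = ya - y *+ i + z *+ i])
             gbinom a i * eps ^+ i.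

Definition mx : mono3 := (p%:Z, 0, 0).
Definition mx0 : mono3 := (0, 1, 0).
Definition mx2 : mono3 := (0, 0, 1).

(* (x + x_0)^{r/p}, (x + x_2)^{r/p} and (x_0 - x_2)^{-2} *)
Definition pow_x_x0 (r : int) : ser3 :=
  binomial_exp (r, 0, 0) mx mx0 1 (r%:~R / p%:R).
Definition pow_x_x2 (r : int) : ser3 :=
  binomial_exp (r, 0, 0) mx mx2 1 (r%:~R / p%:R).
Definition pow_x0_x2 : ser3 := binomial_exp (0, -2, 0) mx0 mx2 (-1) (-2).

Definition kernel (r : nat) : ser3 :=
  ser3_mul
    (ser3_mul (pow_x_x2 r%:Z) (pow_x_x0 (- r%:Z)))
    (ser3_mul
       (fun e => (if e == 0 then 1 - r%:R / p%:R else 0) +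
          r%:R / p%:R * ser3_mul (pow_x_x0 p%:Z) (pow_x_x2 (- p%:Z)) e)
       pow_x0_x2).

End Kernel.

(* Both Heisenberg algebras are of the form
     coprod_{k in Z} U k (x) t^{k/p}  (+)  C c,
   with [U k = h] and [p = 1] in the untwisted case.  A representation on [M] is
   given by the action [a k x] of x (x) t^{k/p} for [x \in U k] (the values of
   [a k] outside [U k] are irrelevant) and the action [c] of the center. *)
Section Heisenberg.
Variables (K : fieldType) (h : vectType K) (form : {symmetric h}).
Variables (U : int -> {vspace h}) (p : nat).

Definition heis_rep (M : lmodType K)
    (a : int -> h -> {linear M -> M}) (c : {linear M -> M}) : Prop :=
  [/\ forall (k : int) (z : K) (x y : h) (v : M), x \in U k -> y \in U k ->
        a k (z *: x + y) v = z *: a k x v + a k y v,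
      forall (k l : int) (x y : h) (v : M), x \in U k -> y \in U l ->
        a k x (a l y v) - a l y (a k x v) =
          (if k + l == 0 then form x y * (k%:~R / p%:R) else 0) *: c v
    & forall (k : int) (x : h) (v : M), x \in U k ->
        c (a k x v) = a k x (c v)].

(* [w] spans a copy of the one-dimensional module of the nonnegative part. *)
Definition heis_vacuum (M : lmodType K)
    (a : int -> h -> {linear M -> M}) (c : {linear M -> M}) (w : M) : Prop :=
  (forall (k : int) (x : h), 0 <= k -> x \in U k -> a k x w = 0) /\ c w = w.

Definition heis_hom (M M' : lmodType K)
    (a : int -> h -> {linear M -> M}) (c : {linear M -> M})
    (a' : int -> h -> {linear M' -> M'}) (c' : {linear M' -> M'})
    (f : {linear M -> M'}) : Prop :=
  (forall (k : int) (x : h) (v : M), x \in U k -> f (a k x v) = a' k x (f v)) /\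
  (forall v : M, f (c v) = c' (f v)).

(* The induced module, specified by its universal property: homomorphisms from
   it to [M] correspond to the homomorphisms from the inducing one-dimensional
   module to [M]. *)
Definition heis_induced (S : lmodType K)
    (a : int -> h -> {linear S -> S}) (c : {linear S -> S}) (vac : S) : Prop :=
  [/\ heis_rep a c, heis_vacuum a c vac
    & forall (M : lmodType K) (a' : int -> h -> {linear M -> M})
        (c' : {linear M -> M}) (w : M),
        heis_rep a' c' -> heis_vacuum a' c' w ->
        (exists f : {linear S -> M}, heis_hom a c a' c' f /\ f vac = w) /\
        (forall f f' : {linear S -> M},
           heis_hom a c a' c' f -> heis_hom a c a' c' f' ->
           f vac = w -> f' vac = w -> f =1 f')].

End Heisenberg.

Section Twisted.
Variables (K : fieldType) (h : vectType K) (form : {symmetric h}).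
Variables (p : nat) (nu : 'End(h)) (omega : K).

Definition h_ (r : int) : {vspace h} := passmx.leigenspace nu (omega ^ r).

(* alpha_(r): the projection on h_(r) along the other h_(s), s in Z/pZ *)
Definition hproj (r : int) : 'End(h) :=
  daddv_pi (h_ r) (\sum_(s < p | omega ^+ s != omega ^ r) h_ s%:Z)%VS.

(* g(al, m, be, n, x): Res_{x_0} Res_{x_2} x_0^{-m} x_2^{-n} extracts the
   coefficient of x_0^{m-1} x_2^{n-1}. *)
Definition gser (al : h) (m : nat) (be : h) (n : nat) : int -> K :=
  fun k => \sum_(1 <= r < p.+1)
    kernel K p r (k, m%:Z - 1, n%:Z - 1) * form (hproj r%:Z al) be.

(* In what follows a sequence [:: (alpha_1, n_1); ...; (alpha_j, n_j)] encodes
   alpha_1(-n_1) ... alpha_j(-n_j) 1. *)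

Section Words.
Variables (S : lmodType K) (aS : int -> h -> {linear S -> S}) (vac : S).

Definition word (s : seq (h * nat)) : S :=
  foldr (fun b v => aS (- b.2%:Z) b.1 v) vac s.

End Words.

Section TwistedFields.
Variables (M : lmodType K) (aM : int -> h -> {linear M -> M}).

(* alpha^nu(k/p) *)
Definition tmode (k : int) (al : h) : {linear M -> M} := aM k (hproj k al).

(* :alpha_1^nu(k_1/p) ... alpha_j^nu(k_j/p): applied to w *)
Definition nord (l : seq (h * int)) (w : M) : M :=
  foldr (fun b v => tmode b.2 b.1 v) w
    ([seq b <- l | b.2 <= 0] ++ [seq b <- l | 0 < b.2]).

(* :prod_l 1/(n_l-1)! (d/dx)^{n_l-1} alpha_l^nu(x):, coefficient of x^{k/p},
   applied to w.  It is computed from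
     1/(n-1)! (d/dx)^{n-1} x^{-k/p-1} = binom(-k/p-1, n-1) x^{-k/p-n}. *)
Definition nprod (s : seq (h * nat)) (k : int) (w : M) : M :=
  \sum_(ks \in [set ks : seq int | size ks = size s /\
                  \sum_(b <- zip s ks) (- b.2 - (p * b.1.2)%N%:Z) = k])
    (\prod_(b <- zip s ks) gbinom (- (b.2%:~R / p%:R) - 1) b.1.2.-1) *:
      nord (zip (unzip1 s) ks) w.

End TwistedFields.

(* f_I(x) for the factors of [s] indexed by [I]; in a partition of [I] into
   pairs, each pair is listed once, as [(i, i')] with [i < i'].  If #|I| is odd
   there are no such partitions and f_I = 0. *)
Section Pairings.
Variable s : seq (h * nat).
Let j := size s.
Let al (i : 'I_j) : h := (tnth (in_tuple s) i).1.
Let n (i : 'I_j) : nat := (tnth (in_tuple s) i).2.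

Definition pairings (I : {set 'I_j}) : {set {set {set 'I_j}}} :=
  [set P : {set {set 'I_j}} | finset.partition P I & [forall B in P, #|B| == 2]].

Definition fser (I : {set 'I_j}) : int -> K := fun k =>
  \sum_(P in pairings I)
    (\big[@ser_mul K K^o / ser_const (1 : K^o)]_(ij : 'I_j * 'I_j |
         (ij.1 < ij.2)%N && ([set ij.1; ij.2]%SET \in P))
       gser (al ij.1) (n ij.1) (al ij.2) (n ij.2)) k.

Definition subword (J : {set 'I_j}) : seq (h * nat) :=
  [seq tnth (in_tuple s) l | l <- enum J].

End Pairings.

Section Maps.
Variables (S : lmodType K) (aS : int -> h -> {linear S -> S}) (vac : S).
Variables (M : lmodType K) (aM : int -> h -> {linear M -> M}).

(* A map S -> (End M)[[x^{1/p}, x^{-1/p}]]; [F v k] is the coefficient of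
   x^{k/p} in F(v, x). *)
Definition field_map : Type := S -> int -> {linear M -> M}.

Definition field_map_linear (F : field_map) : Prop :=
  forall (z : K) (u v : S) (k : int) (w : M),
    F (z *: u + v) k w = z *: F u k w + F v k w.

Definition is_W (W : field_map) : Prop :=
  field_map_linear W /\
  forall s : seq (h * nat), all (fun b => (0 < b.2)%N) s ->
    forall (k : int) (w : M), W (word aS vac s) k w = nprod aM s k w.

Definition is_Y (Y : field_map) : Prop :=
  field_map_linear Y /\
  forall s : seq (h * nat), all (fun b => (0 < b.2)%N) s ->
    forall (k : int) (w : M),
      Y (word aS vac (rev s)) k w =
        \sum_(J : {set 'I_(size s)})
          ser_mul (fser (~: J)%SET) (fun l => nprod aM (subword J) l w) k.

(* The extension W(f(x) v, x) = f(x) W(v, x) to S-valued series [u]. *)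
Definition extend_W (W : field_map) (u : int -> S) (k : int) (w : M) : M :=
  \sum_(l \in [set: int]) W (u l) (k - l) w.

(* Delta_x as an operator on S-valued series.  The pairs (q_1, m), (q_2, n) are
   summed over as ordered pairs, so that each contraction of two factors of a
   vector occurs twice, whereas f_I counts it once: hence the factor 1/2.  For
   example, if d = 1, p = 2, nu = -1 and v = alpha(-1) alpha(-1) 1, then
   Y(v, x) = W(v, x) + x^{-2}/8, g(alpha, 1, alpha, 1, x) = x^{-2}/8, and
   alpha(1) alpha(1) v = 2 1. *)
Definition Delta (d : nat) (e : d.-tuple h) (u : int -> S) : int -> S := fun k =>
  2%:R^-1 *:
  \sum_(q1 < d) \sum_(q2 < d)
    \sum_(mn \in [set mn : nat * nat | (0 < mn.1)%N /\ (0 < mn.2)%N])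
      (mn.1 * mn.2)%N%:R^-1 *:
        ser_mul (gser (tnth e q1) mn.1 (tnth e q2) mn.2)
          (fun l => aS mn.1%:Z (tnth e q1) (aS mn.2%:Z (tnth e q2) (u l))) k.

(* e^{Delta_x} v *)
Definition expDelta (d : nat) (e : d.-tuple h) (v : S) : int -> S := fun k =>
  \sum_(i \in [set: nat]) (i`!)%:R^-1 *: iter i (Delta e) (ser_const v) k.

End Maps.

End Twisted.

(* Main.v *)
From HB Require Import structures.
Require Import Defs.
From mathcomp Require Import all_boot all_order all_algebra.
From mathcomp Require Import boolp classical_sets fsbigop.
From mathcomp Require Import zify ring.
From mathcomp Require Import reals complex.

Set Implicit Arguments.
Unset Strict Implicit.
Unset Printing Implicit Defensive.

Import GRing.Theory.
Local Open Scope classical_set_scope.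
Local Open Scope ring_scope.

(** The kernel defining [g] is homogeneous, so g(al, m, be, n, x) is a scalar times
    x^{-m-n}.  On a word, alpha(m) with m > 0 removes one letter at a time, so
    Delta_x removes one pair of letters and multiplies by its g
    (both orders of the pair occur, which cancels the factor 1/2).  Hence
    Delta_x^i / i! sums over the partial matchings with i pairs: a matching of a
    set with 2i elements arises i times from the choice of one of its pairs and
    a matching of the rest.  Summing over i gives the coefficients f_I, and
    applying W gives Y.  Words span S because a submodule containing the vacuum
    receives a homomorphism from the induced module, whose composite with the
    inclusion is the identity by uniqueness. *)

(** * Finitely supported sums and one-term series *)

Lemma fsum_seq (T : choiceType) (V : nmodType) (A : set T) (r : seq T)
    (F : T -> V) :
    uniq r -> (forall x, x \in r -> A x) ->
    (forall x, A x -> x \notin r -> F x = 0) ->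
  \sum_(x \in A) F x = \sum_(x <- r) F x.
Proof.
move=> ur rA F0; rewrite (fsbigE r) // big_seq_cond [RHS]big_seq.
by apply: eq_bigl => x; apply: andb_idr => /rA ?; rewrite inE.
Qed.

Lemma fsum_only (T : choiceType) (V : nmodType) (F : T -> V) (x0 : T) :
  (forall x, x != x0 -> F x = 0) -> \sum_(x \in [set: T]) F x = F x0.
Proof.
move=> F0; rewrite (@fsum_seq _ _ _ [:: x0]) ?big_seq1 //.
by move=> x _; rewrite inE => /F0.
Qed.

Lemma ser_mul_monomial (K : fieldType) (V : lmodType K) (c : int -> K)
    (a : int) (u : int -> V) (k : int) :
  (forall l, l != a -> c l = 0) -> ser_mul c u k = c a *: u (k - a).
Proof. by move=> c0; apply: fsum_only => l /c0 ->; rewrite scale0r. Qed.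

(** * Homogeneity of the kernel *)

Section Homogeneity.
Variables (K : fieldType) (p : nat).

(** Degree in $x^{1/p}$ when $x_0$ and $x_2$ get the degree $p$ of $x$; this makes $x+x_0$, $x+x_2$
    and $x_0-x_2$ homogeneous. *)
Definition weight (e : int * int * int) : int :=
  e.1.1 + p%:Z * (e.1.2 + e.2).

Definition homogeneous (a : int) (F : ser3 K) :=
  forall e, weight e != a -> F e = 0.

Lemma weightD e e' : weight (e + e') = weight e + weight e'.
Proof. by case: e e' => [[a b] c] [[a' b'] c']; rewrite /weight /=; ring. Qed.

Lemma weightN e : weight (- e) = - weight e.
Proof. by case: e => [[a b] c]; rewrite /weight /=; ring. Qed.

Lemma weightMn e i : weight (e *+ i) = weight e *+ i.
Proof.
elim: i => [|i IH]; last by rewrite !mulrS weightD IH.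
by rewrite !mulr0n /weight /= !addr0 mulr0.
Qed.

Lemma homogeneous_mul a b F G :
  homogeneous a F -> homogeneous b G -> homogeneous (a + b) (ser3_mul F G).
Proof.
move=> hF hG e we; apply: fsbig1 => e' _.
have [we'|/hF ->] := eqVneq (weight e') a; last by rewrite mul0r.
by rewrite hG ?mulr0 // weightD weightN we' subr_eq addrC.
Qed.

(** Each further term of the expansion trades one factor [y] for one factor [z] of the same
    weight. *)
Lemma homogeneous_binomial_exp ya y z eps c :
  weight y = weight z ->
  homogeneous (weight ya) (binomial_exp (K := K) ya y z eps c).
Proof.
move=> yz e we; apply: fsbig1 => i /= ei.
by rewrite ei !weightD weightN !weightMn yz subrK eqxx in we.
Qed.

(** The two fractional powers have opposite weights [r] and [- r], and the middle factor has weight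
    0, so only $(x_0-x_2)^{-2}$ contributes. *)
Lemma homogeneous_kernel r : homogeneous (- (p%:Z * 2)) (@kernel K p r).
Proof.
have h0 s : homogeneous s (pow_x_x0 K p s).
  suff {1}-> : s = weight (s, 0, 0) by apply: homogeneous_binomial_exp;
    rewrite /weight /=; ring.
  by rewrite /weight /=; ring.
have h2 s : homogeneous s (pow_x_x2 K p s).
  suff {1}-> : s = weight (s, 0, 0) by apply: homogeneous_binomial_exp;
    rewrite /weight /=; ring.
  by rewrite /weight /=; ring.
have h02 : homogeneous (- (p%:Z * 2)) (pow_x0_x2 K).
  suff -> : - (p%:Z * 2) = weight (0, -2, 0) by apply: homogeneous_binomial_exp.
  by rewrite /weight /=; ring.
have -> : - (p%:Z * 2) = (r%:Z - r%:Z) + (0 - (p%:Z * 2)) by ring.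
apply: homogeneous_mul; first exact: homogeneous_mul.
apply: homogeneous_mul => // e we.
(* The monomial 1 has weight 0, so the constant of the middle factor is absent at [e]. *)
have -> : (e == 0) = false.
  by apply: contraNF we => /eqP ->; rewrite /weight /=; apply/eqP; ring.
rewrite add0r (_ : ser3_mul _ _ e = 0) ?mulr0 //.
by have := homogeneous_mul (h0 p%:Z) (h2 (- p%:Z)); apply; rewrite subrr.
Qed.

End Homogeneity.

(** * The series g as a monomial *)

Section Coefficient.
Variables (K : fieldType) (h : vectType K) (form : {symmetric h}).
Variables (p : nat) (nu : 'End(h)) (omega : K).

Local Notation gser := (gser form p nu omega).

(* By homogeneity [gser a m b n] is the monomial [gcoef a m b n] x^{-m-n}. *)
Definition gcoef a m b n : K := gser a m b n (- (p * (m + n))%:Z).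

(** At $x_0^{m-1}x_2^{n-1}$ homogeneity reads $k+p(m-1)+p(n-1)=-2p$, which determines $k$. *)
Lemma gser_monomial a m b n k :
  k != - (p * (m + n))%:Z -> gser a m b n k = 0.
Proof.
move=> kn; apply: big1 => r _; rewrite homogeneous_kernel ?mul0r //.
apply: contraNneq kn; rewrite /weight /= => kE; apply/eqP.
have -> : k = - (p%:Z * 2) - p%:Z * (m%:Z - 1 + (n%:Z - 1)) by rewrite -kE; ring.
by rewrite PoszM PoszD; ring.
Qed.

Lemma ser_mul_gser (V : lmodType K) a m b n (u : int -> V) k :
  ser_mul (gser a m b n) u k = gcoef a m b n *: u (k + (p * (m + n))%:Z).
Proof.
by rewrite (@ser_mul_monomial _ _ _ (- (p * (m + n))%:Z)) ?opprK //;
  exact: gser_monomial.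
Qed.

(** Linearity in each vector argument later recombines the expansions of two letters in the
    orthonormal basis. *)
Lemma gcoef_suml (I : Type) (r : seq I) (c : I -> K) (a : I -> h) m b n :
  gcoef (\sum_(i <- r) c i *: a i) m b n = \sum_(i <- r) c i * gcoef (a i) m b n.
Proof.
rewrite /gcoef /gser (eq_bigr _ (fun i _ => mulr_sumr _ _ _ _)) exchange_big.
apply: eq_bigr => s _; rewrite linear_sum linear_sumlz mulr_sumr.
by apply: eq_bigr => i _; rewrite linearZ linearZl_LR /=; ring.
Qed.

Lemma gcoef_sumr (I : Type) (r : seq I) (c : I -> K) a m (b : I -> h) n :
  gcoef a m (\sum_(i <- r) c i *: b i) n = \sum_(i <- r) c i * gcoef a m (b i) n.
Proof.
rewrite /gcoef /gser (eq_bigr _ (fun i _ => mulr_sumr _ _ _ _)) exchange_big.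
apply: eq_bigr => s _; rewrite linear_sumr mulr_sumr.
by apply: eq_bigr => i _; rewrite linearZr_LR /=; ring.
Qed.

End Coefficient.

(** * Sums over perfect matchings *)

Section Matchings.
Variables (K : fieldType) (T : finType) (g : {set T} -> K).
Implicit Types (I B : {set T}) (P : {set {set T}}).

Definition matchings I : {set {set {set T}}} :=
  [set P : {set {set T}} | finset.partition P I & [forall B in P, #|B| == 2]].

(** The hafnian of the weights [g] on the set [I]. *)
Definition matching_sum I : K := \sum_(P in matchings I) \prod_(B in P) g B.

Lemma card_matching I P : P \in matchings I -> #|I| = (#|P| * 2)%N.
Proof.
rewrite inE => /andP[partP /forall_inP P2].
by apply: card_uniform_partition partP => B /P2 /eqP.
Qed.

Lemma matching_sum_odd I : odd #|I| -> matching_sum I = 0.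
Proof.
move=> oddI; apply: big_pred0 => P; apply: contraTF oddI => /card_matching ->.
by rewrite oddM andbF.
Qed.

Lemma matching_sum0 : matching_sum finset.set0 = 1.
Proof.
rewrite /matching_sum (big_pred1 finset.set0) ?big_set0 // => P.
rewrite inE partition_set0; apply: andb_idr => /eqP ->.
by apply/forall_inP => B; rewrite inE.
Qed.

(* A matching of [I] with a distinguished pair [B] is the same as [B] together
   with a matching of the rest, and it has [#|I| / 2] pairs. *)
Lemma matching_sum_rec I :
  \sum_(B : {set T} | (B \subset I) && (#|B| == 2))
     g B * matching_sum (I :\: B)%SET = (#|I|./2)%:R * matching_sum I.
Proof.
transitivity (\sum_(P in matchings I) \sum_(B in P) \prod_(C in P) g C); last first.
  rewrite mulr_sumr; apply: eq_bigr => P PI.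
  by rewrite sumr_const (card_matching PI) muln2 doubleK mulr_natl.
under eq_bigr => B _ do rewrite mulr_sumr.
rewrite !pair_big_dep /=.
rewrite (reindex_onto (fun x : {set {set T}} * {set T} => (x.2, x.1 :\ x.2)%SET)
          (fun x : {set T} * {set {set T}} => (x.1 |: x.2, x.1)%SET)) /=.
  apply: eq_big => [[P B] | [P B]] /=; last first.
    move=> /andP[_ /eqP[PE]].
    by rewrite [RHS](big_setD1 B) //= -PE setU11.
  apply/idP/idP.
    case/andP=> /andP[/andP[BI B2] Q] /eqP[PE].
    move: Q; rewrite !inE => /andP[partQ /forall_inP Q2].
    have BP : B \in P by rewrite -PE setU11.
    rewrite BP andbT; apply/andP; split; last first.
      apply/forall_inP => C CP; have [-> //|CB] := eqVneq C B.
      by apply: Q2; rewrite !inE CB.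
    rewrite -PE -(finset.setID I B) (finset.setIidPr BI); apply: partitionU1 => //.
      by rewrite -card_gt0 (eqP B2).
    by rewrite -setI_eq0 finset.setDE finset.setICA finset.setICr finset.setI0.
  case/andP=> PI BP; move: (PI); rewrite inE => /andP[partP /forall_inP P2].
  rewrite (partitionS partP BP) P2 //= finset.setD1K // eqxx andbT inE
    partitionD1 //=.
  by apply/forall_inP => C; rewrite !inE => /andP[_ /P2].
(* Adding [B] to [Q] and removing it again gives [Q] because [B] is not in [Q]: members of [Q] lie
   in [I :\: B], whereas [B] is a nonempty subset of [I]. *)
move=> [B Q] /= /andP[/andP[BI /eqP B2]]; rewrite inE => /andP[partQ _].
congr pair; rewrite finset.setU1K //; apply: contraTN (BI) => /(partitionS partQ)
  BD.
apply/negP => _; have /cards2P[x [y [_ BE]]] : #|B| == 2 by apply/eqP.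
by have := fintype.subsetP BD x; rewrite BE !inE eqxx => /(_ isT).
Qed.

End Matchings.

(** * Ordered and unordered pairs *)

Section PairWeights.
Variables (K : fieldType) (j : nat) (G : 'I_j * 'I_j -> K).
Local Notation pair_set ij := [set ij.1; ij.2]%SET.

Lemma pair_set_inj (x y : 'I_j * 'I_j) :
  (x.1 < x.2)%N -> (y.1 < y.2)%N -> pair_set x = pair_set y -> x = y.
Proof.
case: x y => [a b] [c d] /= ab cd E.
have := set21 a b; rewrite E !inE => /orP[]/eqP ac.
  have := set22 a b; rewrite E !inE => /orP[]/eqP bd; subst => //.
  by rewrite ltnn in ab.
have := set22 a b; rewrite E !inE => /orP[]/eqP bd; subst; first by lia.
by rewrite ltnn in ab.
Qed.

(* [G] transported to unordered pairs, each of which is [pair_set ij] for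
   exactly one [ij] with [ij.1 < ij.2] *)
Definition pair_weight (B : {set 'I_j}) : K :=
  \prod_(ij : 'I_j * 'I_j | (ij.1 < ij.2)%N && (pair_set ij == B)) G ij.

Lemma pair_weightE (x : 'I_j * 'I_j) :
  (x.1 < x.2)%N -> pair_weight (pair_set x) = G x.
Proof.
move=> xlt; apply: big_pred1 => y; apply/andP/eqP => [[ylt /eqP]|-> //].
exact: pair_set_inj.
Qed.

(** Regroups by blocks the products over $i<i'$ that define $f_I$. The law is arbitrary because
    weights are multiplied while degrees and vectors are added. *)
Lemma big_pair_sets (V : Type) (idx : V) (op : Monoid.com_law idx)
    (F : 'I_j * 'I_j -> V) (P : {set {set 'I_j}}) :
  \big[op/idx]_(x : 'I_j * 'I_j | (x.1 < x.2)%N && (pair_set x \in P)) F x =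
  \big[op/idx]_(B in P)
     \big[op/idx]_(x : 'I_j * 'I_j | (x.1 < x.2)%N && (pair_set x == B)) F x.
Proof.
rewrite (partition_big (fun x => pair_set x) (mem P)) /= => [|x /andP[]//].
apply: eq_bigr => B BP; apply: eq_bigl => x.
by have [->|] := eqVneq (pair_set x) B; rewrite ?BP ?andbT ?andbF.
Qed.

Lemma card2_pair_set (B : {set 'I_j}) :
  #|B| == 2 -> exists2 x : 'I_j * 'I_j, (x.1 < x.2)%N & pair_set x = B.
Proof.
case/cards2P=> a [b [ab ->]]; have [lt|gt|/val_inj E] := ltngtP a b.
- by exists (a, b).
- by exists (b, a) => //=; rewrite finset.setUC.
- by rewrite E eqxx in ab.
Qed.

End PairWeights.

(** The pairs with $a<b$ and those with $b<a$ each run once through the two-element subsets. The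
    resulting 2 cancels the 1/2 in [Delta]. *)
Lemma sum_ordered_pairs (j : nat) (V : nmodType) (J : {set 'I_j})
    (f : {set 'I_j} -> V) :
  \sum_(b in J) \sum_(a in (J :\ b)%SET) f [set a; b]%SET =
  (\sum_(B : {set 'I_j} | (B \subset J) && (#|B| == 2)) f B) *+ 2.
Proof.
have half : \sum_(x : 'I_j * 'I_j |
      (x.1 < x.2)%N && ((x.1 \in J) && (x.2 \in J))) f [set x.1; x.2]%SET
    = \sum_(B : {set 'I_j} | (B \subset J) && (#|B| == 2)) f B.
  transitivity (\sum_(x : 'I_j * 'I_j | (x.1 < x.2)%N && ([set x.1; x.2]%SET \in
      [set B : {set 'I_j} | (B \subset J) && (#|B| == 2)]%SET))
        f [set x.1; x.2]%SET).
    apply: eq_bigl => x; case: ltnP => //= xlt;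
      rewrite inE cards2 finset.subUset !finset.sub1set.
    by rewrite neq_ltn xlt andbT.
  rewrite big_pair_sets; apply: eq_big => [B|B]; first by rewrite inE.
  rewrite inE => /andP[_ /card2_pair_set[x xlt <-]].
  apply: big_pred1 => y; apply/andP/eqP => [[ylt /eqP]|-> //].
  exact: pair_set_inj.
rewrite mulr2n -{1}half -half pair_big_dep /=.
rewrite (bigID (fun x : 'I_j * 'I_j => (x.1 < x.2)%N)) /=; congr (_ + _).
  apply: eq_big => [[b a]|[b a] _] /=; last by rewrite finset.setUC.
  by rewrite !inE; case: ltngtP => // lt; rewrite ?andbF // andbT -val_eqE /=;
    case: ltngtP lt.
rewrite (reindex (fun x : 'I_j * 'I_j => (x.2, x.1))) /=; last first.
  by exists (fun x => (x.2, x.1)) => [[]|[]].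
apply: eq_bigl => [[b a]] /=.
rewrite !inE -leqNgt -val_eqE /=; case: ltngtP => //=; rewrite ?andbF ?andbT //.
by rewrite andbC.
Qed.

(** [ser_mul] is not associative on arbitrary two-sided series, so the product is evaluated factor
    by factor along the list. *)
Lemma ser_prod_monomial (K : fieldType) (T : Type) (r : seq T) (Q : pred T)
    (c : T -> int -> K) (w : T -> nat) (b : T -> K) (k : int) :
    (forall i, Q i -> forall l, c i l = if l == - (w i)%:Z then b i else 0) ->
  (\big[@ser_mul K K^o / ser_const (1 : K^o)]_(i <- r | Q i) c i) k =
  if k == - (\sum_(i <- r | Q i) w i)%N%:Z then \prod_(i <- r | Q i) b i else 0.
Proof.
move=> cE; elim: r k => [|i r IH] k; first by rewrite !big_nil oppr0.
rewrite !big_cons; case: ifP => // Qi.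
rewrite (@ser_mul_monomial _ _ _ (- (w i)%:Z)) => [|l /negPf lw];
  last by rewrite cE ?lw.
rewrite IH cE // eqxx opprK.
rewrite (_ : (k == _) = (k + (w i)%:Z == - (\sum_(i <- r | Q i) w i)%N%:Z));
  last lia.
by case: ifP; rewrite ?scaler0.
Qed.

(** * The series f_I as a monomial *)

Section PairingSeries.
Variables (K : fieldType) (h : vectType K) (form : {symmetric h}).
Variables (p : nat) (nu : 'End(h)) (omega : K) (s : seq (h * nat)).

Definition factor (i : 'I_(size s)) : h * nat := tnth (in_tuple s) i.

Definition factor_gcoef (x : 'I_(size s) * 'I_(size s)) : K :=
  gcoef form p nu omega (factor x.1).1 (factor x.1).2 (factor x.2).1 (factor x.2).2.

Definition degree (I : {set 'I_(size s)}) : nat :=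
  (\sum_(i in I) p * (factor i).2)%N.

Definition contraction (I : {set 'I_(size s)}) : K :=
  matching_sum (pair_weight factor_gcoef) I.

(** Every letter of [I] lies in exactly one pair of a matching, so all matchings give the same power
    of $x$ and only their coefficients add up. *)
Lemma fserE I k :
  fser form p nu omega I k = if k == - (degree I)%:Z then contraction I else 0.
Proof.
rewrite /fser; under eq_bigr => P PI.
  rewrite (@ser_prod_monomial _ _ _ _ _
    (fun x => (p * ((factor x.1).2 + (factor x.2).2))%N) factor_gcoef); last first.
    by move=> x _ l; case: eqP => [->|/eqP /gser_monomial].
  rewrite !big_pair_sets.
  have -> : (\sum_(B in P) \sum_(x : 'I_(size s) * 'I_(size s) |
      (x.1 < x.2)%N && ([set x.1; x.2]%SET == B))
      p * ((factor x.1).2 + (factor x.2).2) = degree I)%N.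
    move: PI; rewrite inE => /andP[partP /forall_inP P2].
    rewrite /degree (set_partition_big _ partP); apply: eq_bigr => B /P2.
    case/card2_pair_set => x xlt <-.
    rewrite (big_pred1 x) => [|y]; last first.
      by apply/andP/eqP => [[ylt /eqP]|-> //]; exact: pair_set_inj.
    rewrite big_setU1 ?big_set1 ?mulnDr // inE.
    by apply: contraTneq xlt => ->; rewrite ltnn.
  over.
by case: eqP => _ //; rewrite big1.
Qed.

End PairingSeries.

(** * Induction on the induced module *)

Section InducedInd.
Variables (K : fieldType) (h : vectType K) (form : {symmetric h}).
Variables (U : int -> {vspace h}) (p : nat).
Variables (S : lmodType K) (a : int -> h -> {linear S -> S}).
Variables (c : {linear S -> S}) (vac : S).
Hypothesis S_induced : heis_induced form U p a c vac.

Variable P : S -> Prop.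
Hypothesis P_vac : P vac.
Hypothesis P_lin : forall z u v, P u -> P v -> P (z *: u + v).
Hypothesis P_mode : forall k x v, x \in U k -> P v -> P (a k x v).
Hypothesis P_center : forall v, P v -> P (c v).

Definition ind_pred : {pred S} := fun v => `[< P v >].

Lemma ind_pred_submod : submod_closed ind_pred.
Proof.
split=> [|z u v /asboolP Pu /asboolP Pv]; last exact/asboolP/P_lin.
(* The zero vector is obtained as [-1 *: vac + vac]. *)
by apply/asboolP; rewrite -(addNr vac) -scaleN1r; apply: P_lin.
Qed.

HB.instance Definition _ := GRing.isSubmodClosed.Build K S ind_pred ind_pred_submod.

Definition ind_sub := {v : S | ind_pred v}.
HB.instance Definition _ := SubChoice.on ind_sub.
HB.instance Definition _ := [SubChoice_isSubLmodule of ind_sub by <:].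

Section Restrict.
Variables (f : {linear S -> S}) (Pf : forall v, P v -> P (f v)).

Lemma ind_stable (v : ind_sub) : ind_pred (f (val v)).
Proof. by apply/asboolP/Pf/asboolP/(valP v). Qed.

Definition ind_restrict (v : ind_sub) : ind_sub := Sub (f (val v)) (ind_stable v).

Lemma ind_restrict_linear : linear ind_restrict.
Proof. by move=> z u v; apply: val_inj; rewrite /= !linearP. Qed.

HB.instance Definition _ :=
  GRing.isLinear.Build K ind_sub ind_sub _ ind_restrict ind_restrict_linear.
End Restrict.

(* [a k x] for [x] outside [U k] need not preserve [P]; 0 lies in every [U k]. *)
Lemma ind_mode_stable k x v :
  P v -> P (a k (if x \in U k then x else 0) v).
Proof. by apply: P_mode; case: ifP; rewrite ?mem0v. Qed.

(** The universal property is used twice: existence for the submodule cut out by [P], uniqueness for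
    endomorphisms of [S]. *)
Lemma heis_induced_ind v : P v.
Proof.
case: S_induced => -[aL aC aZ] [a0 c1] univ.
pose a' k x : {linear ind_sub -> ind_sub} := ind_restrict (@ind_mode_stable k x).
pose c' : {linear ind_sub -> ind_sub} := ind_restrict P_center.
have vacP : ind_pred vac by apply/asboolP.
have rep : heis_rep form U p a' c'.
  split=> [k z x y u xU yU | k l x y u xU yU | k x u xU]; apply: val_inj => /=.
  - by rewrite memvD ?memvZ // xU yU aL.
  - by rewrite xU yU aC.
  - by rewrite xU aZ.
have vcm : heis_vacuum U a' c' (Sub vac vacP : ind_sub).
  split=> [k x k0 xU|]; apply: val_inj => /=; last exact: c1.
  by rewrite xU a0.
have [[f [[fa fc] fv]] _] := univ _ a' c' _ rep vcm.
have [_ uniq] := univ _ a c vac (And3 aL aC aZ) (conj a0 c1).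
suff <- : val (f v) = v by apply/asboolP/(valP (f v)).
apply: (uniq (val \o f) idfun) => //=; last by rewrite fv.
by split=> [k x u xU|u] /=; rewrite ?fa ?fc //= xU.
Qed.

End InducedInd.

(** * Action of the modes on words *)

Section Words.
Variables (K : fieldType) (h : vectType K) (form : {symmetric h}).
Variables (S : lmodType K) (a : int -> h -> {linear S -> S}).
Variables (c : {linear S -> S}) (vac : S).
Hypothesis S_induced : heis_induced form (fun=> fullv) 1 a c vac.

Lemma mode_comm k l x y v : k + l != 0 -> a k x (a l y v) = a l y (a k x v).
Proof.
case: S_induced => -[_ aC _] _ _ /negPf kl; apply: subr0_eq.
by rewrite aC ?memvf // kl scale0r.
Qed.

(** The center fixes the vacuum and commutes with the modes, which generate [S] from it. *)
Lemma center_id v : c v = v.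
Proof.
case: (S_induced) => -[_ _ aZ] [_ c1] _; move: v.
apply: (heis_induced_ind S_induced) => //= [z u v cu cv|k x v _ cv|v cv];
  last by rewrite !cv.
  by rewrite linearP cu cv.
by rewrite aZ ?memvf // cv.
Qed.

Lemma mode_contract (n : nat) x y v :
  a n x (a (- n%:Z) y v) = a (- n%:Z) y (a n x v) + (form x y * n%:R) *: v.
Proof.
case: S_induced => -[_ aC _] _ _; apply/eqP; rewrite addrC -subr_eq aC ?memvf //.
by rewrite subrr eqxx divr1 center_id.
Qed.

Lemma mode_vac (n : nat) x : a n x vac = 0.
Proof. by case: S_induced => _ [a0 _] _; rewrite a0 ?memvf. Qed.

Definition positive (s : seq (h * nat)) := all (fun b => (0 < b.2)%N) s.

(** Two negative indices never sum to 0, so creation modes commute and any letter can be moved to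
    the front. *)
Lemma word_rem b s : positive s -> b \in s ->
  word a vac s = a (- b.2%:Z) b.1 (word a vac (rem b s)).
Proof.
elim: s => //= b' s IH /andP[b'0 s0]; rewrite inE eq_sym.
case: eqP => [-> //|_ /= bs]; rewrite (IH s0 bs) /= mode_comm //.
by have := allP s0 _ bs; lia.
Qed.

Lemma word_perm s s' : positive s -> perm_eq s s' ->
  word a vac s = word a vac s'.
Proof.
elim: s s' => [|b s IH] s' /=; first by rewrite perm_sym => _ /perm_nilP ->.
move=> bs0 pss; have s'0 : positive s' by rewrite /positive -(perm_all _ pss).
have bs' : b \in s' by rewrite -(perm_mem pss) mem_head.
rewrite (word_rem s'0 bs') (IH (rem b s')) //; first by case/andP: bs0.
by rewrite -(perm_cons b) (permPl pss) perm_to_rem.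
Qed.

(** The mode is commuted through to the vacuum, which it kills, leaving one contraction per letter.
    Distinct labels [t] ensure that [rem] deletes the intended occurrence when letters coincide. *)
Lemma mode_word (T : eqType) (f : T -> h * nat) (t : seq T) (m : nat) x :
    positive (map f t) -> uniq t ->
  a m x (word a vac (map f t)) =
  \sum_(i <- t) ((if (f i).2 == m then form x (f i).1 * m%:R else 0) *:
                 word a vac (map f (rem i t))).
Proof.
elim: t => [|i t IH] /=; first by rewrite big_nil mode_vac.
move=> /andP[i0 t0] /andP[it ut]; rewrite big_cons eqxx addrC.
transitivity (a (- (f i).2%:Z) (f i).1 (a m x (word a vac (map f t))) +
    (if (f i).2 == m then form x (f i).1 * m%:R else 0) *: word a vac (map f t)).
  case: eqP => [->|im]; first exact: mode_contract.
  by rewrite scale0r addr0 mode_comm //; lia.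
rewrite IH // linear_sum; congr (_ + _); apply: eq_big_seq => i' i't.
rewrite linearZ /=; case: (eqVneq i i') => [ii'|//].
by rewrite ii' i't in it.
Qed.

Lemma word_ind (P : S -> Prop) :
    (forall z u v, P u -> P v -> P (z *: u + v)) ->
    (forall s, positive s -> P (word a vac s)) ->
  forall v, P v.
Proof.
move=> P_lin P_word v; move: v P P_lin P_word.
(* The induction keeps [P] universally quantified, so that it proves membership in the span of
   words. *)
apply: (heis_induced_ind S_induced) => [|z u v Pu Pv|k x v _ Pv|v Pv] P P_lin
  P_word.
- exact: (P_word [::]).
- exact: P_lin (Pu P P_lin P_word) (Pv P P_lin P_word).
(* The hypothesis for the shifted predicate reduces to a word: a negative mode prepends a letter, a
   nonnegative one contracts letters. *)
- apply: (Pv (fun u => P (a k x u))) => [z u w|s s0]; first by rewrite linearP;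
    exact: P_lin.
  case: k => [m|m]; last by rewrite NegzE; apply: (P_word ((x, m.+1) :: s)).
  (* Letters are labelled by their positions, which are distinct. *)
  rewrite -[s](map_tnth_enum (in_tuple s)) in s0 *.
  rewrite mode_word ?enum_uniq //; elim/big_rec: _ => [|i u _ Pu].
    by rewrite -(addNr vac) -scaleN1r; apply: P_lin; exact: (P_word [::]).
  apply: P_lin => //; apply: P_word; apply/allP => b /mapP[i' /mem_rem i's ->].
  by apply: (allP s0); exact: map_f.
- by rewrite center_id; exact: Pv P_lin P_word.
Qed.
End Words.

(** * Words indexed by sets of positions *)

Section Subwords.
Variables (K : fieldType) (h : vectType K) (form : {symmetric h}).
Variables (S : lmodType K) (a : int -> h -> {linear S -> S}).
Variables (c : {linear S -> S}) (vac : S).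
Hypothesis S_induced : heis_induced form (fun=> fullv) 1 a c vac.
Variable s : seq (h * nat).
Hypothesis s_pos : positive s.

Lemma positive_subword (J : {set 'I_(size s)}) : positive (subword J).
Proof.
by apply/allP => b /mapP[i _ ->]; apply: (allP s_pos); exact: mem_tnth.
Qed.

(** [mode_word] with positions as labels; deleting [i] from the list of [J] agrees with listing
    [J :\ i] up to order, which does not affect the word. *)
Lemma mode_subword (m : nat) x (J : {set 'I_(size s)}) :
  a m x (word a vac (subword J)) =
  \sum_(i in J) ((if (factor i).2 == m then form x (factor i).1 * m%:R else 0) *:
                 word a vac (subword (J :\ i)%SET)).
Proof.
have posJ := positive_subword J.
rewrite (mode_word S_induced) ?enum_uniq // big_enum.
apply: eq_bigr => i iJ.
congr (_ *: _); apply: (word_perm S_induced).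
  apply/allP => b /mapP[i' _ ->]; apply: (allP s_pos); exact: mem_tnth.
apply: perm_map; apply: uniq_perm; rewrite ?rem_uniq ?enum_uniq // => i'.
by rewrite mem_rem_uniq ?enum_uniq // !inE !mem_enum !inE.
Qed.

Lemma word_subwordT : word a vac (subword [set: 'I_(size s)]%SET) = word a vac s.
Proof.
congr (word a vac _); rewrite /subword enum_setT -enumT.
exact: (map_tnth_enum (in_tuple s)).
Qed.

End Subwords.

(** * The exponential of Delta *)

Section Delta.
Variables (K : fieldType) (h : vectType K) (form : {symmetric h}).
Variables (p : nat) (nu : 'End(h)) (omega : K).
Variables (S : lmodType K) (a : int -> h -> {linear S -> S}).
Variables (c : {linear S -> S}) (vac : S).
Hypothesis S_induced : heis_induced form (fun=> fullv) 1 a c vac.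
Variables (d : nat) (e : d.-tuple h).

Local Notation Delta := (Delta form p nu omega a e).
Local Notation gcoef := (gcoef form p nu omega).

(** This bound makes the sum over mode indices in [Delta] finite. *)
Definition bounded (M : nat) (v : S) :=
  forall (m : nat) (x : h), (M < m)%N -> a m x v = 0.

Lemma boundedP M z u v : bounded M u -> bounded M v -> bounded M (z *: u + v).
Proof. by move=> bu bv m x Mm; rewrite linearP bu // bv // scaler0 addr0. Qed.

Lemma bounded0 M : bounded M 0.
Proof. by move=> m x _; rewrite linear0. Qed.

Lemma boundedW M N v : (M <= N)%N -> bounded M v -> bounded N v.
Proof. by move=> MN bv m x Nm; apply: bv; exact: leq_ltn_trans Nm. Qed.

Lemma bounded_mode M (n : nat) y v : (0 < n)%N -> bounded M v -> bounded M (a n y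
  v).
Proof.
move=> n0 bv m x Mm; rewrite (mode_comm S_induced); last by lia.
by rewrite bv // linear0.
Qed.

Definition contraction_index (M : nat) : finType :=
  (('I_d * 'I_d) * ('I_M * 'I_M))%type.

(** [Delta] cut off at mode index [M], with ordinals shifted by one because modes start at 1. Each g
    is replaced by its monomial, whence the shifted argument of [u]. *)
Definition finite_Delta (M : nat) (u : int -> S) : int -> S := fun k =>
  2%:R^-1 *: \sum_(x : contraction_index M)
    ((x.2.1.+1 * x.2.2.+1)%:R^-1 *
      gcoef (tnth e x.1.1) x.2.1.+1 (tnth e x.1.2) x.2.2.+1) *:
    a x.2.1.+1 (tnth e x.1.1) (a x.2.2.+1 (tnth e x.1.2)
      (u (k + (p * (x.2.1.+1 + x.2.2.+1))%:Z))).

Lemma finite_DeltaE M u : (forall k, bounded M (u k)) -> Delta u = finite_Delta M u.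
Proof.
move=> bu; apply/funext => k; rewrite /Defs.Delta /finite_Delta; congr (_ *: _).
pose t (q1 q2 : 'I_d) (m n : nat) : S :=
  ((m.+1 * n.+1)%:R^-1 * gcoef (tnth e q1) m.+1 (tnth e q2) n.+1) *:
    a m.+1 (tnth e q1) (a n.+1 (tnth e q2) (u (k + (p * (m.+1 + n.+1))%:Z))).
rewrite -(pair_bigA _ (fun (q : 'I_d * 'I_d) (mn : 'I_M * 'I_M) =>
  t q.1 q.2 mn.1 mn.2)) /=.
rewrite pair_bigA; apply: eq_bigr => -[q1 q2] _ /=.
rewrite (@fsum_seq _ _ _ [seq (m.+1, n.+1) | m <- iota 0 M, n <- iota 0 M]).
- have -> : iota 0 M = index_iota 0 M by rewrite /index_iota subn0.
  rewrite big_allpairs_dep big_mkord.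
  rewrite -(pair_bigA _ (fun m n : 'I_M => t q1 q2 m n)) /=.
  apply: eq_bigr => m _; rewrite big_mkord; apply: eq_bigr => n _ /=.
  by rewrite ser_mul_gser scalerA.
- by rewrite allpairs_uniq ?iota_uniq // => -[m n] [m' n'] _ _ [-> ->].
- by move=> x /allpairsP[[m n] [_ _ ->]].
- move=> [[|m] [|n]] [] //= _ _ mnM; rewrite ser_mul_gser.
  (* If [n] is too large the inner mode already kills the vector; otherwise the outer one does,
     since the inner mode preserves the bound. *)
  have [nM|nM] := ltnP n M; last by rewrite bu ?linear0 ?scaler0.
  rewrite (@bounded_mode M n.+1) ?scaler0 // ltnS leqNgt.
  apply: contraNN mnM => mM; apply/allpairsP; exists (m, n).
  by rewrite !mem_iota.
Qed.

Lemma finite_Delta_bounded M N u :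
  (forall k, bounded M (u k)) -> forall k, bounded M (finite_Delta N u k).
Proof.
move=> bu k; rewrite -[finite_Delta _ _ _]addr0; apply: boundedP;
  last exact: bounded0.
elim/big_rec: _ => [|x v _ bv]; first exact: bounded0.
by apply: boundedP bv; do 2!apply: bounded_mode => //.
Qed.

Lemma finite_Delta_linear M z u v :
  finite_Delta M (fun k => z *: u k + v k) =
  fun k => z *: finite_Delta M u k + finite_Delta M v k.
Proof.
apply/funext => k; rewrite /finite_Delta scalerA mulrC -scalerA -scalerDr.
congr (_ *: _); rewrite scaler_sumr -big_split; apply: eq_bigr => x _ /=.
by rewrite !linearP.
Qed.

(** Annihilation modes commute with one another, so the bound survives and one cutoff serves all
    powers of [Delta]. *)
Lemma iter_Delta_bounded M u i : (forall k, bounded M (u k)) ->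
  iter i Delta u = iter i (finite_Delta M) u /\
  forall k, bounded M (iter i (finite_Delta M) u k).
Proof.
move=> bu; elim: i => [|i [IH bi]] //=; split; last exact: finite_Delta_bounded.
by rewrite IH (finite_DeltaE bi).
Qed.

(** A common bound replaces [Delta] by its truncation, a finite sum whose linearity is immediate. *)
Lemma iter_Delta_linear M z u v i :
    (forall k, bounded M (u k)) -> (forall k, bounded M (v k)) ->
  iter i Delta (fun k => z *: u k + v k) =
  fun k => z *: iter i Delta u k + iter i Delta v k.
Proof.
move=> bu bv; have buv k : bounded M (z *: u k + v k) by apply: boundedP.
rewrite (iter_Delta_bounded i bu).1 (iter_Delta_bounded i bv).1.
rewrite (iter_Delta_bounded i buv).1; elim: i => //= i ->.
exact: finite_Delta_linear.
Qed.

End Delta.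

(** * Powers of Delta on a word *)

Section DeltaWord.
Variables (K : fieldType) (h : vectType K) (form : {symmetric h}).
Variables (p : nat) (nu : 'End(h)) (omega : K).
Variables (S : lmodType K) (a : int -> h -> {linear S -> S}).
Variables (c : {linear S -> S}) (vac : S).
Hypothesis S_induced : heis_induced form (fun=> fullv) 1 a c vac.
Variables (d : nat) (e : d.-tuple h).
Hypothesis natK_neq0 : forall n, n.+1%:R != 0 :> K.
Hypothesis e_expand : forall x, \sum_(q < d) form (tnth e q) x *: tnth e q = x.

Local Notation Delta := (Delta form p nu omega a e).
Local Notation gcoef := (gcoef form p nu omega).
Hypothesis gcoef_sym : forall x m y n,
  (0 < m)%N -> (0 < n)%N -> gcoef x m y n = gcoef y n x m.

Variables (s : seq (h * nat)) (M : nat).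
Hypothesis s_pos : positive s.
Hypothesis s_le : all (fun b => (b.2 <= M)%N) s.

Local Notation subw J := (word a vac (subword (s := s) J)).
Local Notation G := (factor_gcoef form p nu omega (s := s)).
Local Notation contraction := (contraction form p nu omega (s := s)).

Lemma factor_gt0 i : (0 < (factor (s := s) i).2)%N.
Proof. by apply: (allP s_pos); exact: mem_tnth. Qed.

Lemma factor_le i : ((factor (s := s) i).2 <= M)%N.
Proof. by apply: (allP s_le); exact: mem_tnth. Qed.

Lemma bounded_subword (J : {set 'I_(size s)}) : bounded a M (subw J).
Proof.
move=> m x Mm; rewrite (mode_subword S_induced s_pos) big1 // => i _.
by case: eqP => [im|_]; rewrite ?scale0r //; have := factor_le i; lia.
Qed.

(** The commutators produce $mn$, cancelling $1/(mn)$, and the basis sums turn g of basis vectors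
    into g of the two removed letters. The free factor [phi] will carry the condition on the power
    of $x$. *)
Lemma double_contraction (phi : nat -> nat -> K) (J : {set 'I_(size s)}) :
  \sum_(x : contraction_index d M)
    (phi x.2.1.+1 x.2.2.+1 * ((x.2.1.+1 * x.2.2.+1)%:R^-1 *
      gcoef (tnth e x.1.1) x.2.1.+1 (tnth e x.1.2) x.2.2.+1)) *:
    a x.2.1.+1 (tnth e x.1.1) (a x.2.2.+1 (tnth e x.1.2) (subw J)) =
  \sum_(b in J) \sum_(i in (J :\ b)%SET)
     (phi (factor i).2 (factor b).2 * G (i, b)) *: subw (J :\ b :\ i)%SET.
Proof.
pose hit (i : 'I_(size s)) (m : nat) (q : 'I_d) : K :=
  if (factor i).2 == m then form (tnth e q) (factor i).1 * m%:R else 0.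
pose co (q : 'I_d * 'I_d) (x : 'I_M * 'I_M) (b i : 'I_(size s)) : K :=
  phi x.1.+1 x.2.+1 * ((x.1.+1 * x.2.+1)%:R^-1 *
      gcoef (tnth e q.1) x.1.+1 (tnth e q.2) x.2.+1) *
  (hit b x.2.+1 q.2 * hit i x.1.+1 q.1).
transitivity (\sum_(x : contraction_index d M) \sum_(b in J)
    \sum_(i in (J :\ b)%SET) co x.1 x.2 b i *: subw (J :\ b :\ i)%SET).
  apply: eq_bigr => x _; rewrite (mode_subword S_induced s_pos) linear_sum
    scaler_sumr.
  apply: eq_bigr => b _; rewrite linearZ /= (mode_subword S_induced s_pos)
    !scaler_sumr.
  by apply: eq_bigr => i _; rewrite !scalerA /co /hit !mulrA.
rewrite exchange_big; apply: eq_bigr => b _.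
rewrite exchange_big; apply: eq_bigr => i _.
rewrite -scaler_suml; congr (_ *: _).
rewrite -(pair_bigA _ (fun (q : 'I_d * 'I_d) (x : 'I_M * 'I_M) => co q x b i)) /=.
rewrite exchange_big.
have [i0 iM b0 bM] := And4 (factor_gt0 i) (factor_le i) (factor_gt0 b) (factor_le
  b).
have im : ((factor i).2.-1 < M)%N by rewrite prednK.
have bm : ((factor b).2.-1 < M)%N by rewrite prednK.
(* Only the mode indices of the letters [i] and [b] survive; as ordinals they are one less. *)
rewrite (bigD1 (Ordinal im, Ordinal bm)) //= addrC big1 ?add0r; last first.
  move=> [m n] mn; apply: big1 => q _; rewrite /co /hit /=.
  case: eqP => [bn|_]; last by rewrite mul0r mulr0.
  case: eqP => [in_|_]; last by rewrite !mulr0.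
  by case/eqP: mn; congr pair; apply: val_inj; rewrite /= ?bn ?in_.
rewrite /co /hit /= !prednK // !eqxx.
rewrite /factor_gcoef -[in RHS](e_expand (factor i).1) -[in RHS](e_expand (factor
  b).1).
rewrite gcoef_suml mulr_sumr; under [RHS]eq_bigr => q _ do rewrite gcoef_sumr
  !mulr_sumr.
rewrite pair_bigA /=; apply: eq_bigr => -[q1 q2] _ /=.
have i0' : (factor i).2%:R != 0 :> K by rewrite -(prednK i0).
have b0' : (factor b).2%:R != 0 :> K by rewrite -(prednK b0).
by rewrite natrM; field; rewrite i0' b0'.
Qed.

(** [D] is the set of contracted positions; [i!] counts the orders in which the [i] pairs of a
    matching can be removed. *)
Definition Delta_layer (i : nat) (k : int) : S :=
  \sum_(D : {set 'I_(size s)} | #|D| == i.*2)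
    (if k == - (degree p D)%:Z then i`!%:R * contraction D else 0) *:
    subw (~: D)%SET.

Lemma setDUB (T : finType) (D B : {set T}) : B \subset D -> (D :\: B :|: B)%SET = D.
Proof. by move=> BD; rewrite finset.setUC -{1}(finset.setIidPr BD) finset.setID.
  Qed.

Lemma Delta_layerS i k :
  finite_Delta form p nu omega a e M (Delta_layer i) k = Delta_layer i.+1 k.
Proof.
pose kap (D : {set 'I_(size s)}) (l : int) : K :=
  if l == - (degree p D)%:Z then i`!%:R * contraction D else 0.
pose f (D B : {set 'I_(size s)}) : S :=
  ((if k == - (degree p (D :|: B)%SET)%:Z then i`!%:R * contraction D else 0) *
   pair_weight G B) *: subw (~: (D :|: B))%SET.
transitivity (2%:R^-1 *: \sum_(D : {set 'I_(size s)} | #|D| == i.*2)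
    \sum_(b in (~: D)%SET) \sum_(j in (~: D :\ b)%SET) f D [set j; b]%SET).
  rewrite /finite_Delta; congr (_ *: _).
  under eq_bigr => x _.
    rewrite /Delta_layer !linear_sum /=.
    under eq_bigr => D _ do rewrite linearZ /= linearZ /= scalerA mulrC.
    over.
  rewrite exchange_big; apply: eq_bigr => D _ /=.
  rewrite (double_contraction (fun m n => kap D (k + (p * (m + n))%:Z))).
  apply: eq_bigr => b bD; apply: eq_bigr => j.
  rewrite !inE in bD * => /andP[jb jD]; rewrite /f.
  (* Symmetry of g makes the order of contraction irrelevant. *)
  have -> : pair_weight G [set j; b]%SET = G (j, b).
    have [lt|gt|/val_inj E] := ltngtP j b;
      first exact: (pair_weightE G (x := (j, b))).
      rewrite finset.setUC (pair_weightE G (x := (b, j))) //.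
      by rewrite /factor_gcoef gcoef_sym ?factor_gt0.
    by rewrite E eqxx in jb.
  have -> : (~: (D :|: [set j; b]) = ~: D :\ b :\ j)%SET.
    by apply/setP => x; rewrite !inE; do !case: (_ == _);
      rewrite ?orbT ?orbF ?andbT.
  congr ((_ * _) *: _); rewrite /kap.
  suff -> : degree p (D :|: [set j; b])%SET =
      (degree p D + p * ((factor j).2 + (factor b).2))%N.
    by rewrite PoszD opprD -[_ == _ - _]subr_eq opprK.
  rewrite /degree finset.setUC -finset.setUA !big_setU1 ?inE ?negb_or ?jb ?jD //=.
  by rewrite mulnDr addnA addnC.
under eq_bigr => D _ do rewrite sum_ordered_pairs.
rewrite sumrMnl -scaler_nat scalerA mulVf ?scale1r; last exact: (natK_neq0 1).
rewrite pair_big_dep /=.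
(* The terms are regrouped by the union of the old contracted set and the new pair. *)
rewrite (reindex_onto
  (fun x : {set 'I_(size s)} * {set 'I_(size s)} => (x.1 :\: x.2, x.2)%SET)
  (fun x => (x.1 :|: x.2, x.2)%SET)) /=; last first.
  move=> [D B] /andP[_ /andP[BD _]] /=; congr pair.
  by rewrite finset.setDUl finset.setDv finset.setU0; apply/finset.setDidPl;
    rewrite finset.disjoints_subset finset.subsetC.
rewrite /Delta_layer.
transitivity (\sum_(D : {set 'I_(size s)} | #|D| == i.+1.*2)
   \sum_(B : {set 'I_(size s)} | (B \subset D) && (#|B| == 2)) f (D :\: B)%SET B).
  rewrite pair_big_dep /=; apply: eq_bigl => -[D B] /=.
  apply/andP/andP =>
      [[/andP[/eqP cD /andP[BD cB]] /eqP[DB]]|[/eqP cD /andP[BD /eqP cB]]].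
    have BsD : B \subset D by rewrite -DB finset.subsetUr.
    split; last by rewrite BsD.
    by rewrite -(cardsID B D) (finset.setIidPr BsD) (eqP cB) cD doubleS.
  rewrite cB eqxx andbT finset.setDE finset.setCI finset.setCK finset.subsetUr
    andbT.
  split; last by rewrite -finset.setDE setDUB.
  by have := cardsID B D; rewrite (finset.setIidPr BD) cB cD doubleS => -[<-];
    rewrite finset.setDE.
apply: eq_bigr => D /eqP cD.
transitivity (\sum_(B : {set 'I_(size s)} | (B \subset D) && (#|B| == 2))
  (if k == - (degree p D)%:Z
   then i`!%:R * (pair_weight G B * contraction (D :\: B)%SET) else 0)
    *: subw (~: D)%SET).
  apply: eq_bigr => B /andP[BD _]; rewrite /f setDUB //.
  by case: eqP => _; rewrite ?mul0r // -mulrA [contraction _ * _]mulrC.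
rewrite -scaler_suml; congr (_ *: _); case: eqP => _; last exact: big1.
(* [D] has [2(i+1)] elements, so the recursion supplies the factor [i+1] that turns [i!] into
   [(i+1)!]. *)
rewrite -mulr_sumr matching_sum_rec cD doubleK mulrA -natrM.
by rewrite factS mulnC.
Qed.

Lemma iter_Delta_word i :
  iter i Delta (ser_const (word a vac s)) = Delta_layer i.
Proof.
have bM k : bounded a M (ser_const (word a vac s) k).
  rewrite /ser_const; case: eqP => _; last exact: bounded0.
  by rewrite -word_subwordT; exact: bounded_subword.
rewrite (iter_Delta_bounded p nu omega S_induced e i bM).1; elim: i => [|i IH] /=.
  apply/funext => k; rewrite /Delta_layer (big_pred1 finset.set0) => [|D];
    last first.
    by rewrite cards_eq0.
  rewrite /degree /contraction matching_sum0 big_set0 oppr0 mulr1 finset.setC0.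
  by rewrite word_subwordT /ser_const; case: eqP; rewrite ?scale1r ?scale0r.
by rewrite IH; apply/funext => k; exact: Delta_layerS.
Qed.

End DeltaWord.

(** * Comparison of the two fields *)

Section OrthonormalBasis.
Variables (K : fieldType) (h : vectType K) (form : {symmetric h}).

Lemma formC x y : form x y = form y x.
Proof. by rewrite hermC expr0 mul1r. Qed.

Lemma orthonormal_form (s : seq h) : orthonormal form s ->
  forall i j, (i < size s)%N -> (j < size s)%N ->
    form s`_i s`_j = (i == j)%:R.
Proof.
elim: s => // x s IH; rewrite /orthonormal /= !andbT.
move=> /andP[/andP[/eqP x1 s1] /andP[/allP xs0 ss]].
have xs j : (j < size s)%N -> form x s`_j = 0.
  by move=> js; apply/eqP/xs0/mem_nth.
move=> [|i] [|j] //= ilt jlt; rewrite ?xs //.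
  by rewrite formC xs.
by apply: IH => //; rewrite /orthonormal s1 ss.
Qed.

Lemma orthonormal_expand (d : nat) (e : d.-tuple h) :
    basis_of fullv e -> orthonormal form e ->
  forall x, \sum_(q < d) form (tnth e q) x *: tnth e q = x.
Proof.
move=> e_basis e_on x; rewrite [RHS](coord_basis e_basis (memvf x)).
apply: eq_bigr => q _; rewrite (tnth_nth 0); congr (_ *: _).
rewrite [X in form _ X](coord_basis e_basis (memvf x)) linear_sumr.
rewrite (bigD1 q) //= big1 => [|q' q'q].
  by rewrite linearZr_LR /= (orthonormal_form e_on) ?size_tuple // eqxx mulr1 addr0.
rewrite linearZr_LR /= (orthonormal_form e_on) ?size_tuple // eq_sym.
by rewrite val_eqE (negPf q'q) mulr0.
Qed.

End OrthonormalBasis.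

(** * Y and W on the induced module *)

Section Comparison.
Variables (K : fieldType) (h : vectType K) (form : {symmetric h}).
Variables (p : nat) (nu : 'End(h)) (omega : K).
Variables (S : lmodType K) (a : int -> h -> {linear S -> S}).
Variables (c : {linear S -> S}) (vac : S).
Hypothesis S_induced : heis_induced form (fun=> fullv) 1 a c vac.
Variables (N : lmodType K) (aN : int -> h -> {linear N -> N}).
Variables (Y W : S -> int -> {linear N -> N}).
Hypothesis Y_def : is_Y form p nu omega a vac aN Y.
Hypothesis W_def : is_W p nu omega a vac aN W.

Local Notation gcoef := (gcoef form p nu omega).

(** [is_Y] is stated for the reversed word, which is the same vector. The sum is reindexed by the
    complement [D] of [J], and the monomial $f_D$ merely shifts [k]. *)
Lemma field_word s k w : positive s ->
  Y (word a vac s) k w = \sum_(D : {set 'I_(size s)})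
    contraction form p nu omega D *: W (word a vac (subword (~: D)%SET)) (k +
      (degree p D)%:Z) w.
Proof.
move=> s_pos; have rev_perm : perm_eq s (rev s) by rewrite perm_sym perm_rev.
rewrite (word_perm S_induced s_pos rev_perm) Y_def.2 //.
rewrite (reindex_inj (inv_inj (@finset.setCK _))); apply: eq_bigr => D _.
rewrite (@ser_mul_monomial _ _ _ (- (degree p D)%:Z)); last first.
  by move=> l /negPf lD; rewrite fserE finset.setCK lD.
rewrite fserE finset.setCK eqxx opprK W_def.2 //; exact: positive_subword.
Qed.

Lemma W_vac (w : N) : W vac 0 w = w.
Proof.
rewrite (W_def.2 [::]) // /nprod (@fsum_seq _ _ _ [:: [::]]) //.
- by rewrite big_seq1 /= big_nil scale1r.
- by move=> ks; rewrite inE => /eqP -> /=; rewrite big_nil.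
- by move=> ks [/size0nil -> _].
Qed.

(* A word does not depend on the order of its letters, so [Y] being well defined
   on words of length two forces [g] to be symmetric. *)
Lemma gcoef_sym (w : N) x m y n : w != 0 ->
  (0 < m)%N -> (0 < n)%N -> gcoef x m y n = gcoef y n x m.
Proof.
move=> w0 m0 n0.
(* On two letters, the empty set contributes [W], singletons contribute nothing, and the full set
   contributes g times the identity. *)
have key x' m' y' n' : (0 < m')%N -> (0 < n')%N ->
    gcoef x' m' y' n' *: w =
    Y (word a vac [:: (x', m'); (y', n')]) (- (p * (m' + n'))%:Z) w -
    W (word a vac [:: (x', m'); (y', n')]) (- (p * (m' + n'))%:Z) w.
  move=> m'0 n'0; set s := [:: _; _]; have s_pos : positive s by rewrite /= m'0 n'0.
  rewrite field_word // (bigD1 finset.set0) //= (bigD1 [set: 'I_(size s)]%SET)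
    /=; last first.
    by rewrite -card_gt0 cardsT card_ord.
  rewrite big1 => [|D /andP[D0 DT]]; last first.
    rewrite /contraction matching_sum_odd ?scale0r //.
    have := max_card (mem D); rewrite card_ord /= => D2.
    suff -> : #|D| = 1 by [].
    apply/eqP; rewrite eqn_leq card_gt0 D0 andbT -ltnS ltn_neqAle D2 andbT.
    by apply: contraNN DT => /eqP D2'; rewrite eqEcard finset.subsetT cardsT
      card_ord D2'.
  have -> : degree p (finset.set0 : {set 'I_(size s)}) = 0
    by rewrite /degree big_set0.
  have -> : degree p [set: 'I_(size s)]%SET = (p * (m' + n'))%N.
    by rewrite /degree (eq_bigl xpredT) ?big_ord_recl ?big_ord0 /= ?addn0 ?mulnDr
      // => i; rewrite inE.
  rewrite {1}/contraction matching_sum0 finset.setC0 word_subwordT addr0 addNr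
    scale1r addr0.
  rewrite finset.setCT {1}/subword enum_set0 /= W_vac addrAC subrr add0r;
    congr (_ *: _).
  (* For a two-element set the recursion has the single term [B = I] and the factor 1, so it
     evaluates the matching sum. *)
  have := matching_sum_rec (pair_weight (factor_gcoef form p nu omega (s := s)))
    [set: 'I_(size s)]%SET.
  rewrite cardsT card_ord mul1r /contraction => <-.
  rewrite (big_pred1 [set: 'I_(size s)]%SET) => [|B]; last first.
    rewrite finset.subsetT /=; apply/eqP/eqP => [B2|->];
      last by rewrite cardsT card_ord.
    by apply/eqP; rewrite eqEcard finset.subsetT cardsT card_ord B2.
  rewrite finset.setDv matching_sum0 mulr1.
  have -> : [set: 'I_(size s)]%SET = [set ord0; ord_max : 'I_(size s)]%SET.
    by apply/setP => i; rewrite !inE; case: i => [[|[|]]].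
  by rewrite (pair_weightE _ (x := (ord0, ord_max : 'I_(size s)))).
apply/eqP; rewrite -subr_eq0; suff : (gcoef x m y n - gcoef y n x m) *: w == 0.
  by rewrite scaler_eq0 (negPf w0) orbF.
rewrite scalerBl !key // [X in - (p * X)%:Z]addnC.
have -> : word a vac [:: (x, m); (y, n)] = word a vac [:: (y, n); (x, m)].
  by apply: (word_perm S_induced); rewrite /= ?m0 ?n0 // (perm_catC [:: _] [:: _]).
by rewrite [(n + m)%N]addnC subrr.
Qed.

Variables (d : nat) (e : d.-tuple h).
Hypothesis natK_neq0 : forall n, n.+1%:R != 0 :> K.
Hypothesis e_expand : forall x, \sum_(q < d) form (tnth e q) x *: tnth e q = x.

Local Notation Delta := (Delta form p nu omega a e).
Local Notation expDelta := (expDelta form p nu omega a e).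

(* [x^{l/p}] occurs in [Delta^i v] only for [i < B] and [-B < l <= 0]. *)
Definition tame (B : nat) (v : S) :=
  bounded a B v /\
  forall i l, ~~ ((i < B)%N && (l \in [seq - j%:Z | j <- iota 0 B])) ->
    iter i Delta (ser_const v) l = 0.

Lemma tameW B B' v : (B <= B')%N -> tame B v -> tame B' v.
Proof.
move=> BB' [bv v0]; split=> [|i l il]; first exact: boundedW BB' bv.
apply: v0; apply: contraNN il => /andP[iB /mapP[j jB ->]].
rewrite (leq_trans iB BB') /=; apply/mapP; exists j => //.
by move: jB; rewrite !mem_iota => /andP[_ jB]; exact: leq_trans jB _.
Qed.

Lemma bounded_ser_const B v k : bounded a B v -> bounded a B (ser_const v k).
Proof. by move=> bv; rewrite /ser_const; case: eqP => // _; exact: bounded0. Qed.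

Lemma iter_Delta_ser_const B z u v i k : bounded a B u -> bounded a B v ->
  iter i Delta (ser_const (z *: u + v)) k =
  z *: iter i Delta (ser_const u) k + iter i Delta (ser_const v) k.
Proof.
move=> bu bv.
have -> : ser_const (z *: u + v) = fun l => z *: ser_const u l + ser_const v l.
  by apply/funext => l; rewrite /ser_const; case: eqP; rewrite // scaler0 addr0.
by rewrite (iter_Delta_linear p nu omega S_induced e z (M := B)) // => l;
  exact: bounded_ser_const.
Qed.

Lemma tameP B z u v : tame B u -> tame B v -> tame B (z *: u + v).
Proof.
move=> [bu u0] [bv v0]; split=> [|i l il]; first exact: boundedP.
by rewrite (iter_Delta_ser_const _ _ _ bu bv) u0 // v0 // scaler0 addr0.
Qed.

Lemma expDelta_tame B v l : tame B v ->
  expDelta v l = \sum_(i < B) i`!%:R^-1 *: iter i Delta (ser_const v) l.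
Proof.
move=> [_ v0]; rewrite /Defs.expDelta (@fsum_seq _ _ _ (index_iota 0 B))
  ?iota_uniq //.
  by rewrite big_mkord.
by move=> i _; rewrite mem_index_iota => iB; rewrite v0 ?scaler0 // negb_and iB.
Qed.

Lemma W0 k w : W 0 k w = 0.
Proof. by have := W_def.1 (-1) 0 0 k w; rewrite scaler0 addr0 scaleN1r addNr. Qed.

Lemma W_sum (I : Type) (r : seq I) (Q : pred I) (z : I -> K) (v : I -> S) k w :
  W (\sum_(i <- r | Q i) z i *: v i) k w = \sum_(i <- r | Q i) z i *: W (v i) k w.
Proof.
elim: r => [|i r IH]; first by rewrite !big_nil W0.
by rewrite !big_cons; case: ifP => // _; rewrite W_def.1 IH.
Qed.

Lemma extend_W_tame B v k w : tame B v ->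
  extend_W W (expDelta v) k w = \sum_(j < B) W (expDelta v (- j%:Z)) (k + j%:Z) w.
Proof.
move=> tv; rewrite /extend_W (@fsum_seq _ _ _ [seq - j%:Z | j <- iota 0 B]) //.
- rewrite big_map (_ : iota 0 B = index_iota 0 B);
    last by rewrite /index_iota subn0.
  by rewrite big_mkord; apply: eq_bigr => j _; rewrite opprK.
- by rewrite map_inj_uniq ?iota_uniq // => i j /oppr_inj [].
- move=> l _ lB; rewrite (expDelta_tame _ tv) big1 ?W0 // => i _.
  by rewrite tv.2 ?scaler0 // negb_and lB orbT.
Qed.

(** The common bound gives both series the same finite range of powers and exponents. *)
Lemma extend_W_linear B z u v k w : tame B u -> tame B v ->
  extend_W W (expDelta (z *: u + v)) k w =
  z *: extend_W W (expDelta u) k w + extend_W W (expDelta v) k w.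
Proof.
move=> tu tv; have tuv := tameP z tu tv.
rewrite !(@extend_W_tame B) // scaler_sumr -big_split; apply: eq_bigr => j _ /=.
rewrite -W_def.1; congr (W _ _ _); rewrite !(@expDelta_tame B) // scaler_sumr
  -big_split.
apply: eq_bigr => i _ /=; rewrite (iter_Delta_ser_const _ _ _ tu.1 tv.1).
by rewrite scalerDr !scalerA mulrC.
Qed.

(** * The identity on a single word *)

Section Word.
Hypothesis N_neq0 : exists w : N, w != 0.
Variable s : seq (h * nat).
Hypothesis s_pos : positive s.

Let sym x m y n : (0 < m)%N -> (0 < n)%N -> gcoef x m y n = gcoef y n x m.
Proof. by case: N_neq0 => w w0; exact: gcoef_sym w0. Qed.

(** The three summands bound the mode indices of the letters, the contributing powers of [Delta],
    and the exponents of $x^{-1/p}$. *)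
Let B := (\sum_(b <- s) b.2 + size s + degree p [set: 'I_(size s)]%SET).+1.

Let s_le : all (fun b => (b.2 <= B)%N) s.
Proof.
apply/allP => b bs; suff bB : (b.2 <= \sum_(b <- s) b.2)%N
  by apply: leq_trans bB _; rewrite /B -addnA -addnS leq_addr.
by rewrite (big_rem b bs) leq_addr.
Qed.

Let iterE i :
  iter i Delta (ser_const (word a vac s)) = Delta_layer form p nu omega a vac s i.
Proof. exact: (iter_Delta_word S_induced natK_neq0 e_expand sym s_pos s_le). Qed.

Lemma degree_le (D : {set 'I_(size s)}) : (degree p D <= degree p [set: 'I_(size
  s)]%SET)%N.
Proof.
by rewrite /degree [leqRHS](big_setID D) /= finset.setTI leq_addr.
Qed.

Lemma tame_word : tame B (word a vac s).
Proof.
split=> [|i l il].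
  by rewrite -word_subwordT; exact: (bounded_subword S_induced s_pos s_le).
rewrite iterE /Delta_layer big1 // => D /eqP cD; case: eqP => [lD|_];
  last by rewrite scale0r.
case/negP: il; have dD := degree_le D.
have Ds : (#|D| <= size s)%N by rewrite -[leqRHS]card_ord max_card.
rewrite lD; apply/andP; split; first by rewrite /B; lia.
by apply: (map_f (fun j : nat => - j%:Z)); rewrite mem_iota /B; lia.
Qed.

(** A set [D] of even size occurs only in the layer [i = #|D|/2], where $1/i!$ cancels [i!]; a set
    of odd size has no matching. *)
Lemma expDelta_word l : expDelta (word a vac s) l =
  \sum_(D : {set 'I_(size s)}) (if l == - (degree p D)%:Z
     then contraction form p nu omega D else 0) *: word a vac (subword (~: D)%SET).
Proof.
rewrite (expDelta_tame _ tame_word).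
under eq_bigr => i _.
  rewrite iterE /Delta_layer big_mkcond scaler_sumr.
  over.
rewrite exchange_big; apply: eq_bigr => D _ /=.
have [oddD|evenD] := boolP (odd #|D|).
  rewrite /contraction matching_sum_odd // if_same scale0r big1 // => i _.
  by rewrite mulr0 if_same scale0r if_same scaler0.
have DB : (#|D|./2 < B)%N.
  have Ds : (#|D| <= size s)%N by rewrite -[leqRHS]card_ord max_card.
  by rewrite /B; lia.
rewrite (bigD1 (Ordinal DB)) //= big1 ?addr0 => [|i iD].
  rewrite even_halfK // eqxx scalerA; congr (_ *: _).
  case: eqP => _; rewrite ?mulr0 // mulrA mulVf ?mul1r //.
  by rewrite -(prednK (fact_gt0 _)).
case: eqP => [cD|_]; rewrite ?scaler0 //; case/eqP: iD; apply: val_inj => /=.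
by rewrite cD doubleK.
Qed.

Lemma field_word_expDelta k w :
  Y (word a vac s) k w = extend_W W (expDelta (word a vac s)) k w.
Proof.
rewrite field_word // (extend_W_tame _ _ tame_word).
under [RHS]eq_bigr => j _ do rewrite expDelta_word W_sum.
rewrite exchange_big; apply: eq_bigr => D _ /=.
have DB : (degree p D < B)%N by have := degree_le D; rewrite /B; lia.
(* Among the exponents [- j], the term of [D] occurs only at [j = degree p D]. *)
rewrite (bigD1 (Ordinal DB)) //= eqxx big1 ?addr0 // => j jD.
rewrite eqr_opp; case: eqP => [[jE]|_]; last by rewrite scale0r.
by case/eqP: jD; apply: val_inj.
Qed.

End Word.

Theorem field_expDelta v k w : Y v k w = extend_W W (expDelta v) k w.
Proof.
(* The symmetry of g is extracted from a nonzero vector, so [w = 0] is treated apart. *)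
have [->|w0] := eqVneq w 0.
  by rewrite linear0 /extend_W fsbig1 // => l _; rewrite linear0.
have N_neq0 : exists w : N, w != 0 by exists w.
(* Tameness is carried along because the linear step needs finite sums for both vectors. *)
suff [] : (exists B, tame B v) /\ Y v k w = extend_W W (expDelta v) k w by [].
move: v; apply: (word_ind S_induced) => [z u v [[B tu] IHu] [[B' tv] IHv]|s s_pos].
  have {}tu : tame (B + B') u by apply: tameW tu; rewrite leq_addr.
  have {}tv : tame (B + B') v by apply: tameW tv; rewrite leq_addl.
  split; first by exists (B + B')%N; exact: tameP.
  by rewrite (extend_W_linear _ _ _ tu tv) Y_def.1 IHu IHv.
split; last exact: field_word_expDelta.
by eexists; exact: tame_word.
Qed.

End Comparison.

Theorem mainTheorem4
  (R : realType) (h : vectType R[i]) (form : {symmetric h})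
  (form_nondeg : nondegenerate form)
  (d : nat) (e : d.-tuple h)
  (e_basis : basis_of fullv e) (e_orthonormal : orthonormal form e)
  (p : nat) (p_gt0 : (0 < p)%N)
  (nu : 'End(h)) (nu_isom : isometry form form nu)
  (nu_p : forall x : h, iter p nu x = x)
  (omega : R[i]) (omega_prim : p.-primitive_root omega)
  (S : lmodType R[i]) (aS : int -> h -> {linear S -> S})
  (cS : {linear S -> S}) (vac : S)
  (S_induced : heis_induced form (fun _ => fullv) 1 aS cS vac)
  (Snu : lmodType R[i]) (aN : int -> h -> {linear Snu -> Snu})
  (cN : {linear Snu -> Snu}) (vacN : Snu)
  (Snu_induced : heis_induced form (h_ nu omega) p aN cN vacN)
  (Y W : S -> int -> {linear Snu -> Snu})
  (Y_def : is_Y form p nu omega aS vac aN Y)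
  (W_def : is_W p nu omega aS vac aN W) :
  forall (v : S) (k : int) (w : Snu),
    Y v k w = extend_W W (expDelta form p nu omega aS e v) k w.
Proof.
move=> v k w; apply: (field_expDelta S_induced Y_def W_def) => [n|].
  by rewrite Num.Theory.pnatr_eq0.
exact: orthonormal_expand.
Qed.
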